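(* Let $F$ be a regular distribution supported on $[0,1]$ with smooth PDF, and let $\epsilon>0$. Suppose we have access to a perturbed oracle $F^*$ which, when queried at $x$, returns $F^*(x)=F(x+\epsilon_1)+\epsilon_2$ for some unknown $\epsilon_1\in[-\epsilon^2/2,\epsilon^2/2]$ and $\epsilon_2\in[-\epsilon,\epsilon]$ (which may differ from query to query). Then $\tilde{O}(\epsilon^{-1/2})$ queries to $F^*$ suffice to learn $F$ within Lévy distance $O(\epsilon)$.
   Context: A distribution is smooth if it has no point masses and its PDF $f$ is $C^1$; it is regular iff $f'(v)(1-F(v))\ge-2f(v)^2$ for all $v$ (equivalently $qF^{-1}(1-q)$ concave). Learning within Lévy distance $\eta$ means outputting $\hat F$ with $\mathrm{L\acute{e}vy}(F,\hat F)\le\eta$, where $\mathrm{L\acute{e}vy}(F,G)=\inf\{\epsilon: F(v-\epsilon)-\epsilon\le G(v)\le F(v+\epsilon)+\epsilon\ \forall v\}$. $\tilde{O}$ hides polylog$(1/\epsilon)$ factors. *)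

(* Defs.v *)
From Stdlib Require Import Reals List.
From Coquelicot Require Import Coquelicot.
Open Scope R_scope.

Definition smooth_regular_01 (F f f' : R -> R) : Prop :=
  (forall v, v <= 0 -> F v = 0) /\
  (forall v, 1 <= v -> F v = 1) /\
  (forall u v, u <= v -> F u <= F v) /\
  (forall v, continuous F v) /\
  (forall v, 0 < v < 1 -> is_derive F v (f v)) /\
  (forall v, 0 < v < 1 -> is_derive f v (f' v)) /\
  (forall v, 0 < v < 1 -> continuous f' v) /\
  (forall v, 0 < v < 1 -> f' v * (1 - F v) >= - 2 * (f v) ^ 2).

Definition levy_cond (F G : R -> R) (e : R) : Prop :=
  forall v, F (v - e) - e <= G v <= F (v + e) + e.

Definition levy (F G : R -> R) : Rbar := Glb_Rbar (levy_cond F G).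

Definition prefix (a : nat -> R) (i : nat) : list R := map a (seq 0 i).

(** [a] is a possible sequence of answers of the perturbed oracle F* (with
    perturbation size eps) to the adaptive query strategy [query] during the
    first [n] queries: the i-th query point is [query (prefix a i)], and the
    answer is F(x + e1) + e2 with |e1| <= eps^2/2, |e2| <= eps, chosen
    adversarially (possibly differently) for each query. *)
Definition oracle_consistent (F : R -> R) (eps : R) (n : nat)
    (query : list R -> R) (a : nat -> R) : Prop :=
  forall i, (i < n)%nat ->
    exists e1 e2, Rabs e1 <= eps ^ 2 / 2 /\ Rabs e2 <= eps /\
      a i = F (query (prefix a i) + e1) + e2.

(* Main.v *)
Require Import Defs.
From Stdlib Require Import Reals List.
From Coquelicot Require Import Coquelicot.
From Stdlib Require Import Lra Lia ClassicalEpsilon.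
Open Scope R_scope.

(** [F] is regular iff [h = 1 / (1 - F)] is convex.  On a grid of step [d], convexity
    confines [h] on a cell between a chord and the extension of a neighbouring chord, and the
    resulting uncertainty in [F] is [O(eps)] in Levy distance as soon as
    [(1 + slope of h) * h] grows by a factor of at most [1 + eps / d] around the cell: the
    slope is absorbed by a horizontal shift, the [1] and the [h] by a vertical one.  Since that
    quantity increases from [1] to at most [eps ^ -3] where [1 - F > 512 eps], all but
    [O(d / eps * ln (1 / eps))] cells of the grid have this property.  Hence bisecting only the
    cells which the answers do not yet determine, from step [sqrt eps] down to step [eps],
    costs [O(eps ^ (-1/2) * ln (1 / eps))] queries, as the cell counts are geometric in [d].
    The output is any regular distribution fitting the answers. *)

(** * Regularity as convexity of [1 / (1 - F)] *)

Definition invtail (F : R -> R) (v : R) : R := / (1 - F v).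

(** Convexity of [h] replaces the differential condition, so candidate distributions are compared
    without derivatives. It is a three-point inequality free of division, required only where
    [F z < 1], since [h] takes the junk value [/ 0 = 0] where [F] is 1. *)
Definition regular_cdf (F : R -> R) : Prop :=
  (forall v, v <= 0 -> F v = 0) /\
  (forall v, 1 <= v -> F v = 1) /\
  (forall u v, u <= v -> F u <= F v) /\
  (forall x y z, x < y -> y < z -> F z < 1 ->
     invtail F y * (z - x) <= invtail F x * (z - y) + invtail F z * (y - x)).

Lemma invtail_le F x y : F x <= F y -> F y < 1 -> invtail F x <= invtail F y.
Proof. intros H1 H2. apply Rinv_le_contravar; lra. Qed.

(** The second derivative of [h] is [(f' * (1 - F) + 2 * f ^ 2) / (1 - F) ^ 3], and regularity says
    that its numerator is nonnegative. Derivatives are given only inside [(0, 1)]; left of 0, [h] is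
    constantly 1. *)
Lemma smooth_regular_01_regular_cdf F f f' :
  smooth_regular_01 F f f' -> regular_cdf F.
Proof.
  intros (F0 & F1 & Fmono & Fcont & HF & Hf & _ & Hreg).
  split; [exact F0|]. split; [exact F1|]. split; [exact Fmono|].
  intros x y z xy yz Fz.
  assert (z1 : z < 1) by (apply Rnot_le_lt; intro K; rewrite (F1 z K) in Fz; lra).
  assert (lt1 : forall v, v <= z -> F v < 1)
    by (intros v vz; generalize (Fmono v z vz); lra).
  assert (hle : forall u v, u <= v -> v <= z -> invtail F u <= invtail F v)
    by (intros u v uv vz; apply invtail_le; [now apply Fmono | now apply lt1]).
  pose (h' := fun v => f v / (1 - F v) ^ 2).
  pose (h'' := fun v => (f' v * (1 - F v) + 2 * f v ^ 2) / (1 - F v) ^ 3).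
  assert (dS : forall v, 0 < v <= z -> is_derive (fun v => 1 - F v) v (- f v)).
  { intros v Hv. evar_last.
    - apply @is_derive_minus; [apply @is_derive_const | apply HF; lra].
    - unfold minus, plus, opp, zero; simpl. ring. }
  assert (dh : forall v, 0 < v <= z -> is_derive (invtail F) v (h' v)).
  { intros v Hv. unfold invtail, h'. specialize (lt1 v (proj2 Hv)).
    evar_last.
    - apply is_derive_inv; [now apply dS | lra].
    - simpl. field. lra. }
  assert (ddh : forall v, 0 < v <= z -> is_derive h' v (h'' v)).
  { intros v Hv. unfold h', h''. specialize (lt1 v (proj2 Hv)).
    evar_last.
    - apply is_derive_div; [apply Hf; lra | apply is_derive_pow, dS, Hv | apply pow_nonzero; lra].
    - simpl. field. lra. }
  assert (hmono : forall u v, 0 < u -> u < v -> v <= z -> h' u <= h' v).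
  { intros u v Hu uv vz.
    destruct (MVT_gen h' u v h'') as (c & Hc & E).
    - rewrite Rmin_left, Rmax_right by lra. intros w Hw. apply ddh; lra.
    - rewrite Rmin_left, Rmax_right by lra. intros w Hw.
      apply continuity_pt_filterlim. apply (ex_derive_continuous h').
      eexists. apply ddh; lra.
    - rewrite Rmin_left, Rmax_right in Hc by lra.
      assert (0 <= h'' c).
      { unfold h''. specialize (Hreg c ltac:(lra)). specialize (lt1 c ltac:(lra)).
        apply Rmult_le_pos; [lra|]. left. apply Rinv_0_lt_compat, pow_lt. lra. }
      nra. }
  (* The end [u = 0] is allowed, where only continuity is known, so the intermediate point must be
     strictly interior. *)
  assert (mvt : forall u v, 0 <= u -> u < v -> v <= z ->
             exists c, u < c < v /\ invtail F v - invtail F u = h' c * (v - u)).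
  { intros u v Hu uv vz.
    assert (pr : forall c, u < c < v -> derivable_pt (invtail F) c).
    { intros c Hc. exists (h' c). apply is_derive_Reals, dh; lra. }
    destruct (MVT (invtail F) id u v pr (fun c _ => derivable_pt_id c) uv) as (c & P & E).
    - intros c Hc. apply continuity_pt_inv.
      + apply continuity_pt_minus; [now apply continuity_pt_const|].
        apply continuity_pt_filterlim, Fcont.
      + specialize (lt1 c ltac:(lra)). lra.
    - intros c _. apply derivable_continuous_pt, derivable_pt_id.
    - exists c. split; [exact P|]. rewrite derive_pt_id in E.
      rewrite (derive_pt_eq_0 _ c (h' c)) in E
        by (apply is_derive_Reals, dh; lra).
      unfold id in E. lra. }
  destruct (Rle_or_lt y 0) as [y0|y0].
  { assert (invtail F x = invtail F y) by (unfold invtail; rewrite !F0 by lra; reflexivity).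
    generalize (hle y z ltac:(lra) ltac:(lra)). nra. }
  (* Moving a negative [x] up to 0 leaves [h] unchanged; moving back only lengthens [y - x], which
     is harmless because the slope [h' c] is nonnegative. *)
  assert (E0 : invtail F (Rmax x 0) = invtail F x).
  { unfold invtail, Rmax. destruct (Rle_dec x 0); [rewrite !F0 by lra|]; reflexivity. }
  assert (M0 : 0 <= Rmax x 0 /\ x <= Rmax x 0 /\ Rmax x 0 < y)
    by (unfold Rmax; destruct (Rle_dec x 0); lra).
  destruct (mvt (Rmax x 0) y) as (c & Hc & Ec); [lra..|].
  destruct (mvt y z) as (e & He & Ee); [lra..|].
  generalize (hmono c e ltac:(lra) ltac:(lra) ltac:(lra)); intro Hce.
  generalize (hle (Rmax x 0) y ltac:(lra) ltac:(lra)); intro Hxy.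
  rewrite E0 in *.
  assert (0 <= h' c) by nra.
  assert (invtail F y - invtail F x <= h' c * (y - x)) by nra.
  assert (h' c * (z - y) <= invtail F z - invtail F y) by nra.
  assert (h' c * (y - x) * (z - y) <= (invtail F z - invtail F y) * (y - x)) by nra.
  nra.
Qed.

(** Secant slopes of a convex function increase: from [[a, b]] to [[b, e]] to [[c, e]]. Denominators
    are multiplied out. *)
Lemma invtail_slope F a b c e :
  regular_cdf F -> a < b -> b <= c -> c < e -> F e < 1 ->
  (invtail F b - invtail F a) * (e - c) <= (invtail F e - invtail F c) * (b - a).
Proof.
  intros (_ & _ & _ & cvx) ab bc ce Fe.
  generalize (cvx a b e ab ltac:(lra) Fe); intro H1.
  set (A := invtail F a) in *. set (B := invtail F b) in *. set (E := invtail F e) in *.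
  destruct (Req_dec b c) as [<-|n].
  - fold B. nra.
  - generalize (cvx b c e ltac:(lra) ce Fe); intro H2.
    fold B E in H2. set (C := invtail F c) in *.
    assert (K1 : (B - A) * (e - b) <= (E - B) * (b - a)) by lra.
    assert (K2 : (E - B) * (e - c) <= (E - C) * (e - b)) by lra.
    apply Rmult_le_reg_r with (e - b); [lra|].
    assert (L1 : (B - A) * (e - b) * (e - c) <= (E - B) * (b - a) * (e - c))
      by (apply Rmult_le_compat_r; lra).
    assert (L2 : (E - B) * (e - c) * (b - a) <= (E - C) * (e - b) * (b - a))
      by (apply Rmult_le_compat_r; lra).
    lra.
Qed.

Lemma invtail_ge1 F v : 0 <= F v < 1 -> 1 <= invtail F v.
Proof. intros H. unfold invtail. rewrite <- Rinv_1. apply Rinv_le_contravar; lra. Qed.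

Lemma regular_cdf_bounds F v : regular_cdf F -> 0 <= F v <= 1.
Proof.
  intros (F0 & F1 & mono & _). split.
  - destruct (Rle_or_lt v 0); [rewrite F0; lra|]. rewrite <- (F0 0) by lra. apply mono; lra.
  - destruct (Rle_or_lt 1 v); [rewrite F1; lra|]. rewrite <- (F1 1) by lra. apply mono; lra.
Qed.

(** * Converting between vertical errors of [F] and errors of [h] *)

Lemma inv_le_upper s t h e : h * s = 1 -> 0 < s -> 0 <= e -> 2 * e * h <= 1 ->
  s - e <= t -> / t <= h + 2 * e * h ^ 2.
Proof.
  intros hs s0 e0 eh st.
  assert (h0 : 0 < h) by nra.
  assert (e2 : 2 * e <= s) by nra.
  apply Rle_trans with (/ (s - e)).
  - apply Rinv_le_contravar; lra.
  - apply Rmult_le_reg_r with (s - e); [lra|].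
    rewrite Rinv_l by lra.
    replace ((h + 2 * e * h ^ 2) * (s - e))
      with (h * s + 2 * e * h * (h * s) - e * h - 2 * (e * h) * (e * h)) by ring.
    rewrite hs. assert (0 <= e * h) by nra. nra.
Qed.

Lemma inv_ge_lower s t h e : h * s = 1 -> 0 < s -> 0 <= e -> 0 < t ->
  t <= s + e -> h - e * h ^ 2 <= / t.
Proof.
  intros hs s0 e0 t0 ts.
  assert (h0 : 0 < h) by nra.
  apply Rle_trans with (/ (s + e)).
  - apply Rmult_le_reg_r with (s + e); [lra|].
    rewrite Rinv_l by lra.
    replace ((h - e * h ^ 2) * (s + e))
      with (h * s + e * h - e * h * (h * s) - (e * h) * (e * h)) by ring.
    rewrite hs. nra.
  - apply Rinv_le_contravar; lra.
Qed.

(** The derivative of [1 / (1 - F)] with respect to [F] is [h ^ 2], so a vertical error [e]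
    corresponds to an error of about [e * h ^ 2] in [h]. This lemma and the next three pass in both
    directions; a factor 2 with [2 * e * h <= 1] covers the second-order term where it has the wrong
    sign. *)
Lemma invtail_le_of_le F G x y e : F y < 1 -> 0 <= e -> 2 * e * invtail F y <= 1 ->
  G x <= F y + e -> invtail G x <= invtail F y + 2 * e * invtail F y ^ 2.
Proof.
  intros H1 He H2 H3.
  apply (inv_le_upper (1 - F y)); try lra. unfold invtail; field; lra.
Qed.

Lemma invtail_ge_of_ge F G x y e : F y < 1 -> G x < 1 -> 0 <= e ->
  F y - e <= G x -> invtail F y - e * invtail F y ^ 2 <= invtail G x.
Proof.
  intros H1 H2 He H3.
  apply (inv_ge_lower (1 - F y)); try lra. unfold invtail; field; lra.
Qed.

Lemma le_of_invtail_le F G x y e : F y < 1 -> G x < 1 -> 0 <= e ->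
  invtail G x <= invtail F y + e * invtail F y ^ 2 -> G x <= F y + e.
Proof.
  unfold invtail. intros H1 H2 He H3.
  apply Rmult_le_compat_r with (r := (1 - G x) * (1 - F y) ^ 2) in H3;
    [|apply Rmult_le_pos; [lra | apply pow2_ge_0]].
  field_simplify in H3; try lra.
  assert (0 < 1 - F y) by lra. assert (0 < 1 - G x) by lra.
  set (s := 1 - F y) in *. set (t := 1 - G x) in *.
  assert (K : s * s <= s * t + e * t) by (unfold s, t in *; nra).
  assert (s - e <= t); [|unfold s, t in *; lra].
  apply Rnot_lt_le; intro L. nra.
Qed.

Lemma ge_of_invtail_ge F G x y e : F y < 1 -> G x < 1 -> 0 <= e ->
  2 * e * invtail F y <= 1 ->
  invtail F y - e * invtail F y ^ 2 <= invtail G x -> F y - 2 * e <= G x.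
Proof.
  unfold invtail. intros H1 H2 He H3 H4.
  set (s := 1 - F y) in *. set (t := 1 - G x) in *.
  assert (s0 : 0 < s) by (unfold s; lra). assert (t0 : 0 < t) by (unfold t; lra).
  assert (e2 : 2 * e <= s).
  { apply Rmult_le_compat_r with (r := s) in H3; [|lra].
    rewrite Rmult_assoc, Rinv_l in H3; lra. }
  apply Rmult_le_compat_r with (r := t * s ^ 2) in H4; [|nra].
  replace (/ t * (t * s ^ 2)) with (s ^ 2) in H4 by (field; lra).
  replace ((/ s - e * (/ s) ^ 2) * (t * s ^ 2)) with (t * (s - e)) in H4 by (field; lra).
  assert (t <= s + 2 * e); [|unfold s, t in *; lra].
  apply Rnot_lt_le; intro L.
  assert ((s + 2 * e) * (s - e) < t * (s - e)) by (apply Rmult_lt_compat_r; lra).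
  nra.
Qed.

Lemma sq_le_double x w : 0 <= x -> x <= 2 * w -> x ^ 2 <= 4 * w ^ 2.
Proof. intros. replace (4 * w ^ 2) with ((2 * w) ^ 2) by ring. apply pow_incr; lra. Qed.

Lemma one_le_sq w : 1 <= w -> 1 <= w ^ 2.
Proof. intros. rewrite <- (pow1 2). apply pow_incr; lra. Qed.

(** * Comparison of two regular distributions around a cell [[u, u + d]] *)

Section Transfer.

Variables (F G : R -> R) (eps d u sm sp : R).
Hypotheses (HF : regular_cdf F) (HG : regular_cdf G).
Hypotheses (eps0 : 0 < eps) (eps1 : eps <= / 64) (epsd : 64 * eps <= d).
Let delta := eps ^ 2 / 2.
Let lo := u - 2 * d.
Let hi := u + 4 * d.
Hypothesis slopes : forall y z, lo <= y -> y <= z -> z <= hi ->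
  sm * (z - y) <= invtail F z - invtail F y <= sp * (z - y).
Hypothesis Fhi : F hi < 1 - 512 * eps.
Hypothesis flat : invtail F hi <= 2 * invtail F lo.
Hypotheses (sm0 : 0 <= sm) (curv : (sp - sm) * d <= eps * (1 + sm)).

Let Flt v : v <= hi -> F v < 1 - 512 * eps.
Proof. intros Hv. generalize (proj1 (proj2 (proj2 HF)) v hi Hv). lra. Qed.

Let hsmall v : v <= hi -> 512 * eps * invtail F v <= 1.
Proof.
  intros Hv. specialize (Flt v Hv). unfold invtail.
  apply Rmult_le_reg_r with (1 - F v); [lra|]. rewrite Rmult_assoc, Rinv_l; lra.
Qed.

Let h1 v : v <= hi -> 1 <= invtail F v.
Proof.
  intros Hv. specialize (Flt v Hv). generalize (regular_cdf_bounds F v HF).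
  intros. apply invtail_ge1. lra.
Qed.

Let hmono y z : y <= z -> z <= hi -> invtail F y <= invtail F z.
Proof.
  intros yz Hz. apply invtail_le; [now apply HF|]. specialize (Flt z Hz). lra.
Qed.

Let delta_bounds : 0 < delta /\ delta * 128 <= eps.
Proof. unfold delta. nra. Qed.

(** By convexity [invtail G] lies below its chord between the probes near [u - d] and [u + 2 * d].
    The corresponding chord of [invtail F] exceeds the function by at most a multiple of
    [(sp - sm) * d], hence of [eps * (1 + sm)] by [curv]. A horizontal shift by [eps] pays for
    [eps * sm]; a vertical one pays for [eps] and the oracle errors, whose factors [h ^ 2] at the
    probes are made comparable to the one near [x] by [flat]. *)
Lemma transfer_upper x :
  G (u - d - delta) <= F (u - d + delta) + 2 * eps ->
  G (u + 2 * d - delta) <= F (u + 2 * d + delta) + 2 * eps ->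
  u - d / 2 <= x <= u + 3 * d / 2 ->
  G x <= F (x + 7 * eps) + 20 * eps.
Proof.
  intros Ga Gb Hx. destruct delta_bounds as [del0 del1].
  set (a' := u - d - delta) in *. set (b' := u + 2 * d - delta) in *.
  set (a := u - d + delta) in *. set (b := u + 2 * d + delta) in *.
  (* The abscissas for [F] are those for [G] moved right by [2 * delta]; moving [x] along preserves
     its distances to both ends. *)
  set (y := x + 2 * delta).
  assert (Gb1 : G b' < 1) by (specialize (Flt b ltac:(unfold b, hi; lra)); lra).
  assert (Gx : G x < 1)
    by (generalize (proj1 (proj2 (proj2 HG)) x b' ltac:(unfold b'; lra)); lra).
  generalize (proj2 (proj2 (proj2 HG)) a' x b' ltac:(unfold a'; lra) ltac:(unfold b'; lra) Gb1).
  intro cvx.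
  assert (Ha := hsmall a ltac:(unfold a, hi; lra)).
  assert (Hb := hsmall b ltac:(unfold b, hi; lra)).
  assert (Ha1 := h1 a ltac:(unfold a, hi; lra)).
  assert (Hb1 := h1 b ltac:(unfold b, hi; lra)).
  assert (Ka : invtail G a' <= invtail F a + 2 * (2 * eps) * invtail F a ^ 2).
  { apply invtail_le_of_le; try lra. specialize (Flt a ltac:(unfold a, hi; lra)). lra. }
  assert (Kb : invtail G b' <= invtail F b + 2 * (2 * eps) * invtail F b ^ 2).
  { apply invtail_le_of_le; try lra. specialize (Flt b ltac:(unfold b, hi; lra)). lra. }
  assert (Ya := slopes a y ltac:(unfold a, lo; lra) ltac:(unfold a, y; lra) ltac:(unfold y, hi; lra)).
  assert (Yb := slopes y b ltac:(unfold y, lo; lra) ltac:(unfold b, y; lra) ltac:(unfold b, hi; lra)).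
  assert (Yy := slopes y (y + eps) ltac:(unfold y, lo; lra) ltac:(lra) ltac:(unfold y, hi; lra)).
  assert (Hlo := hmono lo (y + eps) ltac:(unfold lo, y; lra) ltac:(unfold y, hi; lra)).
  assert (Hah := hmono a hi ltac:(unfold a, hi; lra) ltac:(lra)).
  assert (Hbh := hmono b hi ltac:(unfold b, hi; lra) ltac:(lra)).
  assert (H1y := h1 (y + eps) ltac:(unfold y, hi; lra)).
  assert (Fy := Flt (y + eps) ltac:(unfold y, hi; lra)).
  apply Rle_trans with (F (y + eps) + 20 * eps).
  2: { generalize (proj1 (proj2 (proj2 HF)) (y + eps) (x + 7 * eps) ltac:(unfold y; lra)). lra. }
  apply le_of_invtail_le; try lra.
  replace (b' - a') with (3 * d) in cvx by (unfold a', b'; ring).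
  replace (y - a) with (x - a') in Ya by (unfold y, a, a'; ring).
  replace (b - y) with (b' - x) in Yb by (unfold y, b, b'; ring).
  replace (y + eps - y) with eps in Yy by ring.
  assert (pq : (x - a') + (b' - x) = 3 * d) by (unfold a', b'; ring).
  assert (p0 : 0 <= x - a') by (unfold a'; lra).
  assert (q0 : 0 <= b' - x) by (unfold b'; lra).
  set (w := invtail F (y + eps)) in *.
  assert (A2 : invtail F a ^ 2 <= 4 * w ^ 2) by (apply sq_le_double; lra).
  assert (B2 : invtail F b ^ 2 <= 4 * w ^ 2) by (apply sq_le_double; lra).
  set (p := x - a') in *. set (q := b' - x) in *.
  set (hy := invtail F y) in *.
  assert (Ka2 : invtail G a' <= hy - sm * p + 16 * eps * w ^ 2) by (generalize (Rmult_le_compat_l eps _ _ (Rlt_le _ _ eps0) A2) (Rmult_le_compat_l eps _ _ (Rlt_le _ _ eps0) B2); lra).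
  assert (Kb2 : invtail G b' <= hy + sp * q + 16 * eps * w ^ 2) by (generalize (Rmult_le_compat_l eps _ _ (Rlt_le _ _ eps0) A2) (Rmult_le_compat_l eps _ _ (Rlt_le _ _ eps0) B2); lra).
  assert (pq2 : 4 * (p * q) <= 9 * d * d).
  { replace (9 * d * d) with ((p + q) * (p + q)) by (rewrite pq; ring).
    generalize (pow2_ge_0 (p - q)). nra. }
  assert (spsm : 0 <= sp - sm).
  { assert (K : sm * eps <= sp * eps) by lra. apply Rmult_le_reg_r in K; lra. }
  assert (C2 : (sp - sm) * (p * q) <= eps * (1 + sm) * (3 * d)).
  { apply Rle_trans with ((sp - sm) * (9 / 4 * d * d)).
    - apply Rmult_le_compat_l; lra.
    - apply Rle_trans with (eps * (1 + sm) * (9 / 4 * d)).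
      2: { assert (0 <= eps * (1 + sm) * d) by (repeat apply Rmult_le_pos; lra). lra. }
      apply Rle_trans with ((sp - sm) * d * (9 / 4 * d)); [lra|].
      apply Rmult_le_compat_r; lra. }
  assert (M1 : invtail G a' * q <= (hy - sm * p + 16 * eps * w ^ 2) * q)
    by (apply Rmult_le_compat_r; lra).
  assert (M2 : invtail G b' * p <= (hy + sp * q + 16 * eps * w ^ 2) * p)
    by (apply Rmult_le_compat_r; lra).
  assert (Z : invtail G x * (3 * d)
              <= (hy + 16 * eps * w ^ 2 + eps * (1 + sm)) * (3 * d)).
  { apply Rle_trans with ((hy + 16 * eps * w ^ 2) * (p + q) + (sp - sm) * (p * q)).
    - lra.
    - rewrite pq. lra. }
  apply Rmult_le_reg_r in Z; [|lra].
  generalize (Rmult_le_compat_l eps _ _ (Rlt_le _ _ eps0) (one_le_sq w H1y)). lra.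
Qed.

(** By convexity [invtail G x] lies above the leftward extension of the chord between the probes
    near [u + 2 * d] and [u + 3 * d]. The extension can be six times as long as the chord, which
    amplifies the oracle errors and explains the larger constant. *)
Lemma transfer_lower x :
  F (u + 2 * d - delta) - 2 * eps <= G (u + 2 * d + delta) ->
  G (u + 3 * d - delta) <= F (u + 3 * d + delta) + 2 * eps ->
  u - d / 2 <= x <= u + 3 * d / 2 ->
  F (x - 7 * eps) - 336 * eps <= G x.
Proof.
  intros Ga Gb Hx. destruct delta_bounds as [del0 del1].
  set (a' := u + 2 * d + delta) in *. set (b' := u + 3 * d - delta) in *.
  set (a := u + 2 * d - delta) in *. set (b := u + 3 * d + delta) in *.
  (* Here [2 * delta] aligns the abscissas, and [5 * eps] absorbs the error [5 * eps * sm]: three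
     parts come from [M8] and two from [M10]. *)
  set (z := x - 2 * delta - 5 * eps).
  assert (Gb1 : G b' < 1) by (specialize (Flt b ltac:(unfold b, hi; lra)); lra).
  assert (Gx : G x < 1)
    by (generalize (proj1 (proj2 (proj2 HG)) x b' ltac:(unfold b'; lra)); lra).
  assert (Ga1 : G a' < 1)
    by (generalize (proj1 (proj2 (proj2 HG)) a' b' ltac:(unfold a', b'; lra)); lra).
  generalize (proj2 (proj2 (proj2 HG)) x a' b' ltac:(unfold a'; lra) ltac:(unfold a', b'; lra) Gb1).
  intro cvx.
  assert (Hb := hsmall b ltac:(unfold b, hi; lra)).
  assert (Ha1 := h1 a ltac:(unfold a, hi; lra)).
  assert (Hb1 := h1 b ltac:(unfold b, hi; lra)).
  assert (Ka : invtail F a - 2 * eps * invtail F a ^ 2 <= invtail G a').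
  { apply invtail_ge_of_ge; try lra. specialize (Flt a ltac:(unfold a, hi; lra)). lra. }
  assert (Kb : invtail G b' <= invtail F b + 2 * (2 * eps) * invtail F b ^ 2).
  { apply invtail_le_of_le; try lra. specialize (Flt b ltac:(unfold b, hi; lra)). lra. }
  assert (Yab := slopes a b ltac:(unfold a, lo; lra) ltac:(unfold a, b; lra) ltac:(unfold b, hi; lra)).
  assert (Yza := slopes z a ltac:(unfold z, lo; lra) ltac:(unfold a, z; lra) ltac:(unfold a, hi; lra)).
  assert (Hlo := hmono lo z ltac:(unfold lo, z; lra) ltac:(unfold z, hi; lra)).
  assert (Hah := hmono a hi ltac:(unfold a, hi; lra) ltac:(lra)).
  assert (Hbh := hmono b hi ltac:(unfold b, hi; lra) ltac:(lra)).
  assert (H1z := h1 z ltac:(unfold z, hi; lra)).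
  assert (Hz := hsmall z ltac:(unfold z, hi; lra)).
  assert (Fz := Flt z ltac:(unfold z, hi; lra)).
  (* The total error below is [(152 + 4) * eps * w ^ 2], within 168; the margin 512 in [Fhi] ensures
     [2 * (168 * eps) * w <= 1]. *)
  apply Rle_trans with (F z - 2 * (168 * eps)).
  { generalize (proj1 (proj2 (proj2 HF)) (x - 7 * eps) z ltac:(unfold z; lra)). lra. }
  apply ge_of_invtail_ge; try lra.
  replace (b - a) with (d + 2 * delta) in Yab by (unfold a, b; ring).
  replace (b' - a') with (d - 2 * delta) in cvx by (unfold a', b'; ring).
  set (p := a' - x) in *.
  assert (Eq : b' - x = p + (d - 2 * delta)) by (unfold p, a', b'; ring).
  rewrite Eq in cvx.
  replace (a - z) with (p + 5 * eps) in Yza by (unfold p, a, a', z; ring).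
  assert (p0 : d / 2 <= p <= 3 * d) by (unfold p, a'; lra).
  set (w := invtail F z) in *.
  assert (A2 : invtail F a ^ 2 <= 4 * w ^ 2) by (apply sq_le_double; lra).
  assert (B2 : invtail F b ^ 2 <= 4 * w ^ 2) by (apply sq_le_double; lra).
  set (ha := invtail F a) in *.
  assert (Ka2 : ha - 8 * eps * w ^ 2 <= invtail G a') by (generalize (Rmult_le_compat_l eps _ _ (Rlt_le _ _ eps0) A2); lra).
  assert (Kb2 : invtail G b' <= ha + sp * (d + 2 * delta) + 16 * eps * w ^ 2) by (generalize (Rmult_le_compat_l eps _ _ (Rlt_le _ _ eps0) A2) (Rmult_le_compat_l eps _ _ (Rlt_le _ _ eps0) B2); lra).
  assert (spsm : 0 <= sp - sm).
  { assert (K : sm * (d + 2 * delta) <= sp * (d + 2 * delta)) by lra.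
    apply Rmult_le_reg_r in K; lra. }
  set (r := d - 2 * delta) in *.
  assert (r0 : d / 2 < r) by (unfold r; lra).
  assert (M1 : (ha - 8 * eps * w ^ 2) * (p + r) <= invtail G a' * (p + r))
    by (apply Rmult_le_compat_r; lra).
  assert (M2 : invtail G b' * p <= (ha + sp * (d + 2 * delta) + 16 * eps * w ^ 2) * p)
    by (apply Rmult_le_compat_r; lra).
  assert (M3 : ha * r - eps * w ^ 2 * (24 * p + 8 * r) - sp * (r + 4 * delta) * p
               <= invtail G x * r).
  { replace (r + 4 * delta) with (d + 2 * delta) by (unfold r; ring). lra. }
  (* Here the horizontal oracle error has to be [O(eps^2)] rather than [O(eps)]. *)
  assert (M4 : 4 * delta * p <= eps * r).
  { assert (delta * p <= delta * (3 * d)) by (apply Rmult_le_compat_l; lra).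
    assert (delta * d <= eps / 128 * d) by (apply Rmult_le_compat_r; lra).
    assert (eps * (d / 2) <= eps * r) by (apply Rmult_le_compat_l; lra).
    assert (0 < eps * d) by (apply Rmult_lt_0_compat; lra).
    lra. }
  assert (M5 : sp * (r + 4 * delta) * p <= (sp * p + sp * eps) * r).
  { assert (sp * (4 * delta * p) <= sp * (eps * r)) by (apply Rmult_le_compat_l; lra). lra. }
  (* Since [p <= 3 * d < 6 * r], the constant is [24 * 6 + 8]. *)
  assert (M6 : eps * w ^ 2 * (24 * p + 8 * r) <= 152 * eps * w ^ 2 * r).
  { assert (K : 24 * p + 8 * r <= 152 * r) by lra.
    apply (Rmult_le_compat_l (eps * w ^ 2)) in K; [lra|].
    apply Rmult_le_pos; [lra | apply pow2_ge_0]. }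
  assert (M7 : (ha - 152 * eps * w ^ 2 - (sp * p + sp * eps)) * r <= invtail G x * r) by lra.
  apply Rmult_le_reg_r in M7; [|lra].
  assert (M8 : sp * p <= sm * p + 3 * eps * (1 + sm)).
  { assert ((sp - sm) * p <= (sp - sm) * (3 * d)) by (apply Rmult_le_compat_l; lra). lra. }
  assert (M9 : sp - sm <= 1 + sm).
  { apply Rmult_le_reg_r with d; [lra|].
    apply Rle_trans with (eps * (1 + sm)); [lra|].
    rewrite (Rmult_comm eps). apply Rmult_le_compat_l; lra. }
  assert (M10 : sp * eps <= (1 + 2 * sm) * eps) by (apply Rmult_le_compat_r; lra).
  assert (M11 : ha - sm * (p + 5 * eps) - 4 * eps - 152 * eps * w ^ 2 <= invtail G x) by lra.
  generalize (Rmult_le_compat_l eps _ _ (Rlt_le _ _ eps0) (one_le_sq w H1z)). lra.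
Qed.

End Transfer.

(** * Counting the cells around which [(1 + slope) * h] grows noticeably *)

Lemma count_jumps (P : nat -> R) (c B : R) :
  0 < c -> (forall j, P j <= P (S j)) -> (forall j, 0 <= P j <= B) ->
  forall N, exists l : list nat,
    (forall j, (j < N)%nat -> c < P (j + 7)%nat - P j -> In j l) /\
    INR (length l) * c <= 7 * B.
Proof.
  intros c0 mono bnd N.
  (* the sum of the jumps [P (j + 7) - P j] over [j < N] telescopes to [T N - T 0] *)
  pose (T := fun n => P n + P (n + 1)%nat + P (n + 2)%nat + P (n + 3)%nat
                      + P (n + 4)%nat + P (n + 5)%nat + P (n + 6)%nat).
  assert (T_S : forall n, T (S n) = T n + (P (n + 7)%nat - P n)).
  { intro n. unfold T.
    replace (S n + 1)%nat with (n + 2)%nat by lia. replace (S n + 2)%nat with (n + 3)%nat by lia.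
    replace (S n + 3)%nat with (n + 4)%nat by lia. replace (S n + 4)%nat with (n + 5)%nat by lia.
    replace (S n + 5)%nat with (n + 6)%nat by lia. replace (S n + 6)%nat with (n + 7)%nat by lia.
    replace (S n) with (n + 1)%nat by lia. ring. }
  assert (monok : forall n k, P n <= P (n + k)%nat).
  { intros n k. induction k as [|k IH]; [rewrite Nat.add_0_r; lra|].
    rewrite Nat.add_succ_r. specialize (mono (n + k)%nat). lra. }
  assert (main : exists l, (forall j, (j < N)%nat -> c < P (j + 7)%nat - P j -> In j l) /\
                           INR (length l) * c <= T N - T O).
  { induction N as [|N (l & Hl & Hc)].
    - exists nil. split; [intros; lia | simpl; lra].
    - specialize (T_S N). specialize (monok N 7%nat).
      destruct (Rlt_dec c (P (N + 7)%nat - P N)) as [b|b].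
      + exists (N :: l). split.
        * intros j Hj Hb. destruct (Nat.eq_dec j N) as [->|]; [now left|].
          right. apply Hl; [lia | exact Hb].
        * change (length (N :: l)) with (S (length l)). rewrite S_INR. lra.
      + exists l. split; [|lra].
        intros j Hj Hb. destruct (Nat.eq_dec j N) as [->|]; [contradiction|].
        apply Hl; [lia | exact Hb]. }
  destruct main as (l & Hl & Hc). exists l. split; [exact Hl|].
  assert (T N <= 7 * B) by (unfold T; generalize (bnd N) (bnd (N + 1)%nat) (bnd (N + 2)%nat)
    (bnd (N + 3)%nat) (bnd (N + 4)%nat) (bnd (N + 5)%nat) (bnd (N + 6)%nat); lra).
  assert (0 <= T O) by (unfold T; generalize (bnd 0%nat) (bnd (0 + 1)%nat) (bnd (0 + 2)%nat)
    (bnd (0 + 3)%nat) (bnd (0 + 4)%nat) (bnd (0 + 5)%nat) (bnd (0 + 6)%nat); lra).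
  lra.
Qed.

(** The hidden shifts are eliminated by monotonicity; candidates are tested against this consequence
    only. *)
Definition oracle_ok (F : R -> R) (eps x a : R) : Prop :=
  F (x - eps ^ 2 / 2) - eps <= a <= F (x + eps ^ 2 / 2) + eps.

(** For [u = INR j * d], the indices [j] and [j + 7] give the secants over [[u - 3 * d, u - 2 * d]]
    and [[u + 4 * d, u + 5 * d]], just outside the window used in the comparison. They serve as [sm]
    and [sp]. *)
Definition grid_slope (F : R -> R) (d : R) (j : nat) : R :=
  (invtail F ((INR j - 2) * d) - invtail F ((INR j - 3) * d)) / d.

Definition grid_weight (F : R -> R) (d : R) (j : nat) : R :=
  (1 + grid_slope F d j) * invtail F ((INR j - 3) * d).

(* The value [3 * ln (/ eps) + 1] exceeds every [ln (grid_weight F d j)] occurring in the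
   other branch by at least [1], so the passage from one branch to the other is a jump. *)
Definition potential (F : R -> R) (eps d : R) (j : nat) : R :=
  if Rle_dec (1 - 512 * eps) (F ((INR j - 2) * d)) then 3 * ln (/ eps) + 1
  else ln (grid_weight F d j).

Section Potential.

Variables (F : R -> R) (eps d : R).
Hypotheses (HF : regular_cdf F).
Hypotheses (eps0 : 0 < eps) (eps1 : eps <= / 64) (epsd : 64 * eps <= d).

Let Fmono u v : u <= v -> F u <= F v := proj1 (proj2 (proj2 HF)) u v.

Lemma invtail_bounds v : F v < 1 - 512 * eps -> 1 <= invtail F v <= / (512 * eps).
Proof.
  intros Hv. split.
  - apply invtail_ge1. generalize (regular_cdf_bounds F v HF). lra.
  - apply Rinv_le_contravar; lra.
Qed.

Lemma grid_slope_ge0 j : F ((INR j - 2) * d) < 1 -> 0 <= grid_slope F d j.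
Proof.
  intros Hj. unfold grid_slope. apply Rmult_le_pos; [|left; apply Rinv_0_lt_compat; lra].
  assert (H : F ((INR j - 3) * d) <= F ((INR j - 2) * d)) by (apply Fmono; nra).
  generalize (invtail_le F ((INR j - 3) * d) ((INR j - 2) * d) H Hj). lra.
Qed.

Lemma grid_slope_S j : F ((INR (S j) - 2) * d) < 1 -> grid_slope F d j <= grid_slope F d (S j).
Proof.
  rewrite S_INR. intros Hj. unfold grid_slope. rewrite S_INR.
  apply Rmult_le_compat_r; [left; apply Rinv_0_lt_compat; lra|].
  generalize (invtail_slope F ((INR j - 3) * d) ((INR j - 2) * d) ((INR j + 1 - 3) * d)
    ((INR j + 1 - 2) * d) HF ltac:(nra) ltac:(nra) ltac:(nra) Hj).
  intro K. apply Rmult_le_reg_r with d; [lra|].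
  replace ((INR j + 1 - 2) * d - (INR j + 1 - 3) * d) with d in K by ring.
  replace ((INR j - 2) * d - (INR j - 3) * d) with d in K by ring. exact K.
Qed.

Lemma grid_weight_ge1 j : F ((INR j - 2) * d) < 1 - 512 * eps -> 1 <= grid_weight F d j.
Proof.
  intros Hj. unfold grid_weight.
  generalize (grid_slope_ge0 j ltac:(lra)).
  assert (H1 : F ((INR j - 3) * d) <= F ((INR j - 2) * d)) by (apply Fmono; nra).
  generalize (invtail_bounds ((INR j - 3) * d) ltac:(lra)).
  intros. rewrite <- (Rmult_1_l 1). apply Rmult_le_compat; lra.
Qed.

(** Here [h <= / eps] and the slope is at most [h / d <= / eps ^ 2 / 64], so the weight is at most
    [/ eps ^ 3]. *)
Lemma ln_grid_weight_le j : F ((INR j - 2) * d) < 1 - 512 * eps ->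
  ln (grid_weight F d j) <= 3 * ln (/ eps).
Proof.
  intros Hj. assert (ie : 0 < / eps) by now apply Rinv_0_lt_compat.
  replace (3 * ln (/ eps)) with (ln (/ eps ^ 3)).
  2: { rewrite <- pow_inv. rewrite ln_pow by exact ie. simpl; ring. }
  apply ln_le; [generalize (grid_weight_ge1 j Hj); lra|].
  assert (H1 : F ((INR j - 3) * d) <= F ((INR j - 2) * d)) by (apply Fmono; nra).
  generalize (invtail_bounds ((INR j - 3) * d) ltac:(lra)); intros [A1 A2].
  generalize (invtail_bounds ((INR j - 2) * d) ltac:(lra)); intros [B1 B2].
  assert (ie64 : 64 <= / eps).
  { rewrite <- (Rinv_inv 64). apply Rinv_le_contravar; lra. }
  assert (k : / (512 * eps) <= / eps) by (apply Rinv_le_contravar; lra).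
  assert (id : / d <= / (64 * eps)) by (apply Rinv_le_contravar; lra).
  rewrite Rinv_mult in id.
  assert (id0 : 0 < / d) by (apply Rinv_0_lt_compat; lra).
  assert (S1 : grid_slope F d j <= / eps * (/ eps / 64)).
  { unfold grid_slope, Rdiv. apply Rmult_le_compat; try lra.
    generalize (invtail_le F ((INR j - 3) * d) ((INR j - 2) * d) H1 ltac:(lra)). lra. }
  unfold grid_weight. rewrite <- pow_inv.
  replace ((/ eps) ^ 3) with ((/ eps) ^ 2 * / eps) by ring.
  apply Rmult_le_compat; try lra.
  - generalize (grid_slope_ge0 j ltac:(lra)). lra.
  - nra.
Qed.

Lemma ln_inv_eps_ge0 : 0 <= ln (/ eps).
Proof.
  rewrite <- ln_1. apply ln_le; [lra|]. rewrite <- Rinv_1. apply Rinv_le_contravar; lra.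
Qed.

Lemma potential_bounds j : 0 <= potential F eps d j <= 3 * ln (/ eps) + 1.
Proof.
  generalize ln_inv_eps_ge0; intro L.
  unfold potential. destruct (Rle_dec _ _) as [H|H]; [lra|]. apply Rnot_le_lt in H. split.
  - rewrite <- ln_1. apply ln_le; [lra|]. now apply grid_weight_ge1.
  - generalize (ln_grid_weight_le j H). lra.
Qed.

Lemma potential_S j : potential F eps d j <= potential F eps d (S j).
Proof.
  unfold potential at 2. destruct (Rle_dec _ _) as [H|H]; [apply potential_bounds|].
  apply Rnot_le_lt in H.
  assert (H1 : F ((INR j - 2) * d) <= F ((INR (S j) - 2) * d))
    by (apply Fmono; rewrite S_INR; nra).
  unfold potential. destruct (Rle_dec _ _) as [H2|H2]; [lra|]. clear H2.
  apply ln_le; [generalize (grid_weight_ge1 j ltac:(lra)); lra|].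
  unfold grid_weight. apply Rmult_le_compat.
  - generalize (grid_slope_ge0 j ltac:(lra)). lra.
  - assert (H2 : F ((INR j - 3) * d) <= F ((INR j - 2) * d)) by (apply Fmono; nra).
    generalize (invtail_bounds ((INR j - 3) * d) ltac:(lra)). lra.
  - generalize (grid_slope_S j ltac:(lra)). lra.
  - apply invtail_le; [apply Fmono; rewrite S_INR; nra|].
    replace (INR (S j) - 3) with (INR j - 2) by (rewrite S_INR; ring). lra.
Qed.

Lemma exp_le_inv x : 0 <= x <= / 2 -> exp x <= 1 + 2 * x.
Proof.
  intros Hx. generalize (exp_ineq1_le (- x)); intro H.
  assert (E : exp x * exp (- x) = 1) by (rewrite <- exp_plus, Rplus_opp_r; apply exp_0).
  generalize (exp_pos x). nra.
Qed.

(** The weight is a product of two nondecreasing factors, so a small rise of its logarithm limits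
    the rise of each. The range of [x] exceeds the cell by [d / 2] on both sides, which leaves room
    for shifts when two candidates are compared through a third. *)
Lemma small_jump_close G j x :
  regular_cdf G ->
  potential F eps d (j + 7) - potential F eps d j <= eps / (2 * d) ->
  (forall q, In q (INR j - 1 :: INR j + 2 :: INR j + 3 :: nil) ->
     exists a, oracle_ok F eps (q * d) a /\ oracle_ok G eps (q * d) a) ->
  (INR j - / 2) * d <= x <= (INR j + 3 / 2) * d ->
  F (x - 7 * eps) - 520 * eps <= G x <= F (x + 7 * eps) + 520 * eps.
Proof.
  intros HG jump data Hx.
  assert (Gmono : forall u v, u <= v -> G u <= G v) by apply HG.
  assert (ed : 0 <= eps / (2 * d) <= / 128).
  { split; [apply Rmult_le_pos; [lra | left; apply Rinv_0_lt_compat; lra]|].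
    apply Rmult_le_reg_r with (2 * d); [lra|]. unfold Rdiv.
    rewrite Rmult_assoc, Rinv_l; lra. }
  set (u := INR j * d).
  assert (del : 0 < eps ^ 2 / 2 /\ eps ^ 2 / 2 <= eps) by (split; nra).
  assert (data' : forall q, In q (INR j - 1 :: INR j + 2 :: INR j + 3 :: nil) ->
     F (q * d - eps ^ 2 / 2) - 2 * eps <= G (q * d + eps ^ 2 / 2) /\
     G (q * d - eps ^ 2 / 2) <= F (q * d + eps ^ 2 / 2) + 2 * eps).
  { intros q Hq. destruct (data q Hq) as (a & Fa & Ga). unfold oracle_ok in *. lra. }
  clear data.
  destruct (data' (INR j - 1)) as [d0 d0']; [simpl; tauto|].
  destruct (data' (INR j + 2)) as [d1 d1']; [simpl; tauto|].
  destruct (data' (INR j + 3)) as [d2 d2']; [simpl; tauto|].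
  clear data'.
  replace ((INR j - 1) * d) with (u - d) in * by (unfold u; ring).
  replace ((INR j + 2) * d) with (u + 2 * d) in * by (unfold u; ring).
  replace ((INR j + 3) * d) with (u + 3 * d) in * by (unfold u; ring).
  replace ((INR j - / 2) * d) with (u - d / 2) in Hx by (unfold u; field).
  replace ((INR j + 3 / 2) * d) with (u + 3 * d / 2) in Hx by (unfold u; field).
  unfold potential at 2 in jump. destruct (Rle_dec _ _) as [H|H].
  (* Near the top, [F] is at least [1 - 512 * eps] from [u - 2 * d] on, and the probe at [u - d]
     forces [G x >= 1 - 514 * eps]. *)
  - clear jump. replace ((INR j - 2) * d) with (u - 2 * d) in H by (unfold u; ring).
    split.
    + generalize (proj2 (regular_cdf_bounds F (x - 7 * eps) HF)).
      generalize (Fmono (u - 2 * d) (u - d - eps ^ 2 / 2) ltac:(lra)).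
      generalize (Gmono (u - d + eps ^ 2 / 2) x ltac:(lra)). lra.
    + generalize (proj2 (regular_cdf_bounds G x HG)).
      generalize (Fmono (u - 2 * d) (x + 7 * eps) ltac:(lra)). lra.
  - apply Rnot_le_lt in H.
    unfold potential in jump. destruct (Rle_dec _ _) as [H'|H'].
    (* A change of branch is a jump of at least 1, but [eps / (2 * d) <= / 128]. *)
    { generalize (ln_grid_weight_le j H). lra. }
    apply Rnot_le_lt in H'.
    generalize (grid_weight_ge1 j H) (grid_weight_ge1 (j + 7) H'); intros w1 w1'.
    assert (ratio : grid_weight F d (j + 7) <= grid_weight F d j * (1 + eps / d)).
    { rewrite <- (exp_ln (grid_weight F d (j + 7))) by lra.
      replace (ln (grid_weight F d (j + 7)))
        with (ln (grid_weight F d j)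
              + (ln (grid_weight F d (j + 7)) - ln (grid_weight F d j))) by ring.
      rewrite exp_plus, exp_ln by lra.
      apply Rmult_le_compat_l; [lra|].
      apply Rle_trans with (exp (eps / (2 * d))).
      - destruct jump as [jump|jump]; [left; now apply exp_increasing | rewrite jump; lra].
      - replace (eps / d) with (2 * (eps / (2 * d))) by (field; lra).
        apply exp_le_inv. lra. }
    assert (sl : forall y z, u - 2 * d <= y -> y < z -> z <= u + 4 * d ->
      grid_slope F d j * (z - y) <= invtail F z - invtail F y
        <= grid_slope F d (j + 7) * (z - y)).
    { assert (E7 : INR (j + 7) = INR j + 7) by (rewrite plus_INR; simpl; ring).
      intros y z Hy yz Hz. unfold grid_slope. rewrite E7 in *.
      assert (Fz : F z < 1).
      { generalize (Fmono z ((INR j + 7 - 2) * d) ltac:(unfold u in Hz; lra)). lra. }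
      split; apply Rmult_le_reg_r with d; try lra.
      - generalize (invtail_slope F ((INR j - 3) * d) ((INR j - 2) * d) y z HF
          ltac:(lra) ltac:(unfold u in Hy; lra) yz Fz).
        replace ((INR j - 2) * d - (INR j - 3) * d) with d by ring.
        intro K. eapply Rle_trans; [|exact K]. right. field. lra.
      - generalize (invtail_slope F y z ((INR j + 7 - 3) * d) ((INR j + 7 - 2) * d) HF
          yz ltac:(unfold u in Hz; lra) ltac:(lra) ltac:(lra)).
        replace ((INR j + 7 - 2) * d - (INR j + 7 - 3) * d) with d by ring.
        intro K. eapply Rle_trans; [exact K|]. right. field. lra. }
    assert (s0 : 0 <= grid_slope F d j) by (apply grid_slope_ge0; lra).
    assert (E7 : (INR (j + 7) - 3) * d = u + 4 * d)
      by (rewrite plus_INR; unfold u; simpl; ring).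
    assert (E7' : (INR (j + 7) - 2) * d = u + 5 * d)
      by (rewrite plus_INR; unfold u; simpl; ring).
    assert (E0 : (INR j - 3) * d = u - 3 * d) by (unfold u; ring).
    assert (E0' : (INR j - 2) * d = u - 2 * d) by (unfold u; ring).
    unfold grid_weight in ratio, w1, w1'. rewrite ?E7, ?E0 in *. rewrite E7' in H'. rewrite E0' in H.
    assert (Fhi : F (u + 4 * d) < 1 - 512 * eps)
      by (generalize (Fmono (u + 4 * d) (u + 5 * d) ltac:(lra)); lra).
    assert (hmono : forall y z, y <= z -> z <= u + 4 * d -> invtail F y <= invtail F z).
    { intros y z yz Hz. apply invtail_le; [now apply Fmono|].
      generalize (Fmono z (u + 4 * d) Hz). lra. }
    assert (h1 : 1 <= invtail F (u - 3 * d)).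
    { apply invtail_bounds. generalize (Fmono (u - 3 * d) (u + 4 * d) ltac:(lra)). lra. }
    generalize (hmono (u - 3 * d) (u - 2 * d) ltac:(lra) ltac:(lra)); intro hl.
    generalize (hmono (u - 2 * d) (u + 4 * d) ltac:(lra) ltac:(lra)); intro hr.
    assert (sm_sp : grid_slope F d j <= grid_slope F d (j + 7)).
    { generalize (sl (u - 2 * d) (u - d) ltac:(lra) ltac:(lra) ltac:(lra)). intros [K1 K2].
      apply Rmult_le_reg_r with (u - d - (u - 2 * d)); lra. }
    assert (ed' : 0 <= eps / d <= / 64)
      by (replace (eps / d) with (2 * (eps / (2 * d))) by (field; lra); lra).
    set (sm := grid_slope F d j) in *. set (sp := grid_slope F d (j + 7)) in *.
    set (hm := invtail F (u - 3 * d)) in *. set (hp := invtail F (u + 4 * d)) in *.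
    set (r := eps / d) in *.
    (* Bounding [hp] below by [hm] in the ratio and cancelling [hm] gives [curv]; bounding [sp]
       below by [sm] and cancelling [1 + sm] gives [flat]. *)
    assert (curv : (sp - sm) * d <= eps * (1 + sm)).
    { assert (K : (1 + sp) * hm <= (1 + sm) * (1 + r) * hm).
      { apply Rle_trans with ((1 + sp) * hp); [apply Rmult_le_compat_l; lra | lra]. }
      apply Rmult_le_reg_r in K; [|lra].
      replace eps with (r * d) by (unfold r; field; lra).
      replace (r * d * (1 + sm)) with ((r * (1 + sm)) * d) by ring.
      apply Rmult_le_compat_r; lra. }
    assert (flat : hp <= 2 * invtail F (u - 2 * d)).
    { assert (K : hp * (1 + sm) <= (1 + r) * hm * (1 + sm)).
      { apply Rle_trans with ((1 + sp) * hp); [|lra].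
        rewrite (Rmult_comm hp). apply Rmult_le_compat_r; lra. }
      apply Rmult_le_reg_r in K; [|lra].
      assert ((1 + r) * hm <= 2 * hm) by (apply Rmult_le_compat_r; lra).
      lra. }
    assert (sl' : forall y z, u - 2 * d <= y -> y <= z -> z <= u + 4 * d ->
      sm * (z - y) <= invtail F z - invtail F y <= sp * (z - y)).
    { intros y z Hy [yz|<-] Hz; [now apply sl|]. rewrite !Rminus_diag. lra. }
    split.
    + generalize (transfer_lower F G eps d u sm sp HF HG eps0 eps1 epsd sl' Fhi flat s0 curv
        x d1 d2' Hx). lra.
    + generalize (transfer_upper F G eps d u sm sp HF HG eps0 eps1 epsd sl' Fhi flat s0 curv
        x d0' d1' Hx). lra.
Qed.

End Potential.

(** * Certificates and the bisection of undetermined cells *)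

Definition fits (eps : R) (F : R -> R) (st : list (R * R)) : Prop :=
  regular_cdf F /\ List.Forall (fun p => oracle_ok F eps (fst p) (snd p)) st.

Definition mesh (eps : R) (k : nat) : R := 64 * eps * 2 ^ k.

(** The chord from [j - 1] to [j + 2] bounds [h] from above on the cell; the one from [j + 2] to
    [j + 3], extended to the left, bounds it from below. *)
Definition probes (eps : R) (k j : nat) : list R :=
  map (fun q => q * mesh eps k) (INR j - 1 :: INR j + 2 :: INR j + 3 :: nil).

Definition close_on (eps : R) (F G : R -> R) (k j : nat) : Prop :=
  forall x, INR j * mesh eps k <= x <= (INR j + 1) * mesh eps k ->
    F (x - 1040 * eps) - 1040 * eps <= G x <= F (x + 1040 * eps) + 1040 * eps.

(* Quantifying over all pairs, rather than comparing with the unknown distribution, lets the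
   query strategy depend on this property. *)
Definition certified (eps : R) (st : list (R * R)) (k j : nat) : Prop :=
  forall F G, fits eps F st -> fits eps G st -> close_on eps F G k j.

(* [reached eps m st k j]: the bisection has arrived at the cell
   [[INR j * mesh eps k, (INR j + 1) * mesh eps k]]; the level [k] decreases from [m] to [0]. *)
Inductive reached (eps : R) (m : nat) (st : list (R * R)) : nat -> nat -> Prop :=
| reached_top j : (j < 2 ^ m)%nat -> reached eps m st m j
| reached_child k j j' :
    reached eps m st (S k) j -> incl (probes eps (S k) j) (map fst st) ->
    ~ certified eps st (S k) j -> j' = (2 * j)%nat \/ j' = (2 * j + 1)%nat ->
    reached eps m st k j'.

Definition wanted (eps : R) (m : nat) (st : list (R * R)) (x : R) : Prop :=
  exists k j, reached eps m st k j /\ In x (probes eps k j) /\ ~ In x (map fst st).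

Lemma mesh_S eps k : mesh eps (S k) = 2 * mesh eps k.
Proof. unfold mesh. simpl. ring. Qed.

Lemma pow2_ge1 k : 1 <= 2 ^ k.
Proof. apply pow_R1_Rle. lra. Qed.

Lemma mesh_ge eps k : 0 < eps -> 64 * eps <= mesh eps k.
Proof. intros H. unfold mesh. generalize (pow2_ge1 k). nra. Qed.

Lemma fits_probe eps F st x : fits eps F st -> forall a, In (x, a) st -> oracle_ok F eps x a.
Proof.
  intros [_ H] a Ha. rewrite Forall_forall in H. exact (H _ Ha).
Qed.

(** If one fitting [F] has a small jump, every fitting distribution is close to [F], so any two are
    close to each other with doubled error. Thus failure of a certificate, which does not mention
    the true distribution, forces a jump of its potential. *)
Lemma jump_of_not_certified eps F st k j :
  0 < eps <= / 64 -> fits eps F st ->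
  incl (probes eps k j) (map fst st) -> ~ certified eps st k j ->
  eps / (2 * mesh eps k) < potential F eps (mesh eps k) (j + 7) - potential F eps (mesh eps k) j.
Proof.
  intros He HF Hin Hc. apply Rnot_le_lt. intro jump. apply Hc. clear Hc.
  assert (md : 64 * eps <= mesh eps k) by (apply mesh_ge; lra).
  assert (near : forall G, fits eps G st -> forall x,
    (INR j - / 2) * mesh eps k <= x <= (INR j + 3 / 2) * mesh eps k ->
    F (x - 7 * eps) - 520 * eps <= G x <= F (x + 7 * eps) + 520 * eps).
  { intros G HG x Hx.
    apply (small_jump_close F eps (mesh eps k) (proj1 HF)) with (j := j); try tauto; try lra.
    - apply HG.
    - intros q Hq.
      assert (K : In (q * mesh eps k) (map fst st))
        by (apply Hin; apply (in_map (fun q => q * mesh eps k)); exact Hq).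
      apply in_map_iff in K. destruct K as ((y & a) & E & K). simpl in E. subst y.
      exists a. split; eapply fits_probe; eauto. }
  intros G1 G2 H1 H2 x Hx.
  assert (mono : forall G, fits eps G st -> forall u v, u <= v -> G u <= G v)
    by (intros G HG; apply HG).
  generalize (near G2 H2 x ltac:(lra)); intros [L2 U2].
  (* Two shifts by [7 * eps] are composed; [14 * eps] is less than half the step, so the enlarged
     range suffices. *)
  generalize (near G1 H1 (x - 14 * eps) ltac:(lra)); intros [_ U1].
  generalize (near G1 H1 (x + 14 * eps) ltac:(lra)); intros [L1 _].
  replace (x - 14 * eps + 7 * eps) with (x - 7 * eps) in U1 by ring.
  replace (x + 14 * eps - 7 * eps) with (x + 7 * eps) in L1 by ring.
  generalize (mono G1 H1 (x - 1040 * eps) (x - 14 * eps) ltac:(lra))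
    (mono G1 H1 (x + 14 * eps) (x + 1040 * eps) ltac:(lra)). lra.
Qed.

(** At step [64 * eps] monotonicity alone suffices: the probes at [j - 1] and [j + 2] lie within
    [129 * eps] of the cell's points. Bisection therefore ends at level 0. *)
Lemma certified_finest eps st j :
  0 < eps <= / 64 -> incl (probes eps 0 j) (map fst st) -> certified eps st 0 j.
Proof.
  intros He Hin F G HF HG x Hx.
  set (d := mesh eps 0) in *. assert (Ed : d = 64 * eps) by (unfold d, mesh; simpl; ring).
  assert (del : 0 < eps ^ 2 / 2 /\ eps ^ 2 / 2 <= eps) by (split; nra).
  assert (data : forall q, In q (INR j - 1 :: INR j + 2 :: INR j + 3 :: nil) ->
     F (q * d - eps ^ 2 / 2) - 2 * eps <= G (q * d + eps ^ 2 / 2) /\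
     G (q * d - eps ^ 2 / 2) <= F (q * d + eps ^ 2 / 2) + 2 * eps).
  { intros q Hq.
    assert (K : In (q * d) (map fst st))
      by (apply Hin; apply (in_map (fun q => q * d)); exact Hq).
    apply in_map_iff in K. destruct K as ((y & a) & E & K). simpl in E. subst y.
    generalize (fits_probe eps F st _ HF a K) (fits_probe eps G st _ HG a K).
    unfold oracle_ok. lra. }
  destruct (data (INR j - 1)) as [L _]; [simpl; tauto|].
  destruct (data (INR j + 2)) as [_ U]; [simpl; tauto|].
  assert (Fm : forall u v, u <= v -> F u <= F v) by apply HF.
  assert (Gm : forall u v, u <= v -> G u <= G v) by apply HG.
  split.
  - generalize (Fm (x - 1040 * eps) ((INR j - 1) * d - eps ^ 2 / 2) ltac:(lra)).
    generalize (Gm ((INR j - 1) * d + eps ^ 2 / 2) x ltac:(lra)). lra.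
  - generalize (Fm ((INR j + 2) * d + eps ^ 2 / 2) (x + 1040 * eps) ltac:(lra)).
    generalize (Gm x ((INR j + 2) * d - eps ^ 2 / 2) ltac:(lra)). lra.
Qed.

(** With all probes of reached cells answered, a reached cell is either certified or has both halves
    reached, and closeness passes up from the halves. *)
Lemma close_of_nothing_wanted eps m st F G :
  0 < eps <= / 64 -> (forall x, ~ wanted eps m st x) -> fits eps F st -> fits eps G st ->
  forall k j, reached eps m st k j -> close_on eps F G k j.
Proof.
  intros He Hw HF HG.
  assert (full : forall k j, reached eps m st k j -> incl (probes eps k j) (map fst st)).
  { intros k j Hr x Hx. apply NNPP. intro Hn. apply (Hw x). exists k, j. tauto. }
  induction k as [|k IH]; intros j Hr.
  - apply (certified_finest eps st); auto.
  - destruct (classic (certified eps st (S k) j)) as [c|c]; [now apply c|].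
    assert (R0 : reached eps m st k (2 * j)) by (apply reached_child with j; auto).
    assert (R1 : reached eps m st k (2 * j + 1)) by (apply reached_child with j; auto).
    intros x Hx. rewrite mesh_S in Hx.
    assert (E : INR (2 * j) = 2 * INR j) by (rewrite mult_INR; simpl; ring).
    assert (E1 : INR (2 * j + 1) = 2 * INR j + 1) by (rewrite plus_INR, E; simpl; ring).
    destruct (Rle_or_lt x ((2 * INR j + 1) * mesh eps k)) as [l|l].
    + apply (IH _ R0). rewrite E. lra.
    + apply (IH _ R1). rewrite E1. lra.
Qed.

(** * Bounding the number of queries *)

Lemma reached_range eps m st k j :
  reached eps m st k j -> (k <= m)%nat /\ (j < 2 ^ (2 * m - k))%nat.
Proof.
  induction 1 as [j Hj | k j j' _ [Hk IH] _ _ Hj'].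
  - split; [lia|]. replace (2 * m - m)%nat with m by lia. exact Hj.
  (* The [2 ^ m] cells of level [m] double at each of the [m - k] levels below. *)
  - split; [lia|]. replace (2 * m - k)%nat with (S (2 * m - S k)) by lia.
    rewrite Nat.pow_succ_r'. lia.
Qed.

Lemma flat_map_length_const {A B} (f : A -> list B) (c : nat) (l : list A) :
  (forall x, length (f x) = c) -> length (flat_map f l) = (c * length l)%nat.
Proof.
  intros H. induction l as [|x l IH]; simpl; [lia|]. rewrite length_app, H, IH. lia.
Qed.

(** At level [S k] there are at most [7 * 128 * 2 ^ S k * (3 * ln (/ eps) + 1)] jumps, each paying
    for the six probes of two children. As [6 * 7 * 128 * 2 = 10752], summing the powers of 2 over
    the levels gives the bound, uniformly in the cut-off [N]. *)
Lemma jump_probes eps F (N : nat -> nat) M :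
  0 < eps <= / 64 -> regular_cdf F ->
  exists L : list R,
    (forall k j j', (k < M)%nat -> (j < N k)%nat ->
       eps / (2 * mesh eps (S k)) <
         potential F eps (mesh eps (S k)) (j + 7) - potential F eps (mesh eps (S k)) j ->
       j' = (2 * j)%nat \/ j' = (2 * j + 1)%nat -> incl (probes eps k j') L) /\
    INR (length L) <= 10752 * (3 * ln (/ eps) + 1) * (2 ^ M - 1).
Proof.
  intros He HF. induction M as [|M (L & HL & HlenL)].
  - exists nil. split; [intros; lia | simpl; lra].
  - assert (md := mesh_ge eps (S M) (proj1 He)).
    destruct (count_jumps (potential F eps (mesh eps (S M))) (eps / (2 * mesh eps (S M)))
                (3 * ln (/ eps) + 1)) with (N := N M) as (l & Hl & Hlen).
    + apply Rdiv_lt_0_compat; lra.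
    + intro j. apply potential_S; try tauto; lra.
    + intro j. apply potential_bounds; try tauto; lra.
    + exists (L ++ flat_map (fun j => probes eps M (2 * j) ++ probes eps M (2 * j + 1)) l).
      split.
      * intros k j j' Hk Hj jump Hj'. destruct (Nat.eq_dec k M) as [->|].
        -- apply incl_appr. intros x Hx. apply in_flat_map. exists j.
           split; [now apply Hl|]. apply in_or_app.
           destruct Hj' as [->| ->]; [now left | now right].
        -- apply incl_appl. apply (HL k j j'); auto; lia.
      * rewrite length_app, (flat_map_length_const _ 6) by reflexivity.
        rewrite plus_INR, mult_INR.
        assert (K : INR (length l) <= 7 * (3 * ln (/ eps) + 1) * (128 * 2 ^ S M)).
        { apply Rmult_le_reg_r with (eps / (2 * mesh eps (S M)));
            [apply Rdiv_lt_0_compat; lra|].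
          eapply Rle_trans; [exact Hlen|]. right. unfold mesh. field.
          split; [apply pow_nonzero|]; lra. }
        replace (INR 6) with 6 by (simpl; ring).
        change (2 ^ S M) with (2 * 2 ^ M) in *. lra.
Qed.

(** The list is fixed by [F] before any answers are seen, so it contains the queries of every
    adaptive run. The [3 * 2 ^ m] top-level probes raise 10752 to 10755. *)
Lemma wanted_list eps m F :
  0 < eps <= / 64 -> regular_cdf F ->
  exists L : list R,
    (forall st x, fits eps F st -> wanted eps m st x -> In x L) /\
    INR (length L) <= 10755 * (3 * ln (/ eps) + 1) * 2 ^ m.
Proof.
  intros He HF.
  destruct (jump_probes eps F (fun k => (2 ^ (2 * m - S k))%nat) m He HF) as (L & HL & Hlen).
  exists (flat_map (probes eps m) (seq 0 (2 ^ m)) ++ L). split.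
  - intros st x Hst (k & j & Hr & Hx & _). apply in_or_app.
    inversion Hr as [j0 Hj0 E1 E2 | k0 j0 j1 Hr0 Hin Hc Hj E1 E2]; subst.
    + left. apply in_flat_map. exists j. split; [apply in_seq; lia | exact Hx].
    + right. destruct (reached_range _ _ _ _ _ Hr0) as [Hk Hj0].
      apply (HL k j0 j); auto. now apply (jump_of_not_certified eps F st).
  - rewrite length_app, (flat_map_length_const _ 3) by reflexivity.
    rewrite length_seq, plus_INR, mult_INR, pow_INR.
    replace (INR 3) with 3 by (simpl; ring). replace (INR 2) with 2 by (simpl; ring).
    assert (0 <= ln (/ eps)) by (apply ln_inv_eps_ge0; lra).
    generalize (pow2_ge1 m). nra.
Qed.

(** * The adaptive strategy: ask for any wanted point *)

Section Strategy.

Variable want : list (R * R) -> R -> Prop.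

(** When nothing is wanted, the point is unspecified; its answer is still valid and only adds a
    constraint. *)
Definition ask (st : list (R * R)) : R := epsilon (inhabits 0) (want st).

Definition record (st : list (R * R)) (a : R) : list (R * R) := (ask st, a) :: st.

Definition run (l : list R) : list (R * R) := fold_left record l nil.

Lemma run_prefix_S a i :
  run (prefix a (S i)) = (ask (run (prefix a i)), a i) :: run (prefix a i).
Proof. unfold run, prefix. rewrite seq_S, map_app, fold_left_app. reflexivity. Qed.

Lemma want_exhausted a n (L : list R) :
  (forall st x, want st x -> ~ In x (map fst st)) ->
  (forall i x, (i < n)%nat -> want (run (prefix a i)) x -> In x L) ->
  (length L < n)%nat ->
  exists i, (i <= n)%nat /\ forall x, ~ want (run (prefix a i)) x.
Proof.
  intros fresh inL short. apply NNPP. intro Hno.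
  assert (Hw : forall i, (i <= n)%nat -> want (run (prefix a i)) (ask (run (prefix a i)))).
  { intros i Hi. unfold ask. apply epsilon_spec. apply NNPP. intro H. apply Hno.
    exists i. split; [exact Hi|]. intros x Hx. apply H. now exists x. }
  assert (K : forall i, (i <= n)%nat ->
    NoDup (map fst (run (prefix a i))) /\ incl (map fst (run (prefix a i))) L /\
    length (map fst (run (prefix a i))) = i).
  { induction i as [|i IH]; intros Hi.
    - repeat split; [constructor | intros x []].
    - destruct (IH ltac:(lia)) as (K1 & K2 & K3). specialize (Hw i ltac:(lia)).
      rewrite run_prefix_S. simpl. repeat split.
      + constructor; [now apply fresh | exact K1].
      + apply incl_cons; [now apply (inL i) | exact K2].
      + now rewrite K3. }
  destruct (K n (le_n n)) as (K1 & K2 & K3).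
  generalize (NoDup_incl_length K1 K2). lia.
Qed.

Lemma fits_prefix eps F a i n :
  (i <= n)%nat -> fits eps F (run (prefix a n)) -> fits eps F (run (prefix a i)).
Proof.
  induction 1 as [|n _ IH]; [auto|]. rewrite run_prefix_S. intros [HF H].
  apply IH. split; [exact HF|]. now inversion H.
Qed.

Lemma oracle_consistent_fits eps F n a :
  regular_cdf F -> oracle_consistent F eps n (fun l => ask (run l)) a ->
  fits eps F (run (prefix a n)).
Proof.
  intros HF H. split; [exact HF|].
  induction n as [|n IH]; [constructor|]. rewrite run_prefix_S. constructor.
  - destruct (H n ltac:(lia)) as (e1 & e2 & H1 & H2 & E). simpl. rewrite E.
    assert (mono : forall u v, u <= v -> F u <= F v) by apply HF.
    apply Rabs_le_between in H1. apply Rabs_le_between in H2.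
    set (q := ask (run (prefix a n))).
    generalize (mono (q - eps ^ 2 / 2) (q + e1) ltac:(lra))
      (mono (q + e1) (q + eps ^ 2 / 2) ltac:(lra)).
    unfold oracle_ok. lra.
  - apply IH. intros i Hi. apply H. lia.
Qed.

End Strategy.

(** * Choice of parameters and conclusion *)

Lemma pow2_bracket x : 1 <= x -> exists m, 2 ^ m <= x < 2 ^ S m.
Proof.
  intros Hx. destruct (Pow_x_infinity 2 ltac:(rewrite Rabs_pos_eq; lra) (x + 1)) as (N & HN).
  specialize (HN N (le_n N)). rewrite Rabs_pos_eq in HN by (apply pow_le; lra).
  induction N as [|N IH]; [simpl in HN; lra|].
  destruct (Rle_or_lt (2 ^ N) x) as [l|l].
  - exists N. lra.
  - destruct (Rle_or_lt (x + 1) (2 ^ N)); [apply IH; lra|].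
    (* Now [2 ^ N] is between [x] and [x + 1], so the descent restarts with the weaker bound
       [x < 2 ^ N]. *)
    clear IH. assert (Hl := l). clear HN H.
    induction N as [|N IHN]; [simpl in l; lra|].
    destruct (Rle_or_lt (2 ^ N) x); [exists N; lra | auto].
Qed.

Lemma levy_le F G e :
  (forall v, 0 <= v <= 1 -> F (v - e) - e <= G v <= F (v + e) + e) -> 0 <= e ->
  regular_cdf F -> regular_cdf G -> Rbar_le (levy F G) e.
Proof.
  intros H He HF HG. apply (proj1 (Glb_Rbar_correct (levy_cond F G))).
  intros v. destruct (Rlt_or_le v 0) as [l|l]; [|destruct (Rle_or_lt v 1) as [r|r]].
  - rewrite (proj1 HG v), (proj1 HF (v - e)) by lra.
    generalize (regular_cdf_bounds F (v + e) HF). lra.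
  - apply H. lra.
  - rewrite (proj1 (proj2 HG) v), (proj1 (proj2 HF) (v + e)) by lra.
    generalize (regular_cdf_bounds F (v - e) HF). lra.
Qed.

Theorem theorem8 :
  exists (C : R) (K : nat) (eps0 : R), 0 < C /\ 0 < eps0 /\
  forall eps : R, 0 < eps < eps0 ->
    exists (n : nat) (query : list R -> R) (output : list R -> (R -> R)),
      INR n <= C * / sqrt eps * (ln (/ eps)) ^ K /\
      forall (F f f' : R -> R) (a : nat -> R),
        smooth_regular_01 F f f' ->
        oracle_consistent F eps n query a ->
        Rbar_le (levy F (output (prefix a n))) (Finite (C * eps)).
Proof.
  (* The constant covers [4 * 10755 + 1] for the query count and 1040 for the accuracy. *)
  exists 50000, 1%nat, (/ 64). split; [lra|]. split; [lra|]. intros eps He.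
  assert (se : 0 < sqrt eps) by (apply sqrt_lt_R0; lra).
  assert (ss : sqrt eps * sqrt eps = eps) by (apply sqrt_sqrt; lra).
  assert (L1 : 1 <= ln (/ eps)).
  { rewrite <- (ln_exp 1). apply ln_le; [apply exp_pos|].
    apply Rle_trans with 64; [generalize exp_le_3; lra|].
    rewrite <- (Rinv_inv 64). apply Rinv_le_contravar; lra. }
  assert (is1 : 1 <= / sqrt eps) by (rewrite <- Rinv_1; apply Rinv_le_contravar; nra).
  destruct (pow2_bracket (/ sqrt eps) is1) as (m & Hm & Hm').
  set (b := 10755 * (3 * ln (/ eps) + 1) * 2 ^ m).
  assert (pm := pow2_ge1 m).
  assert (b0 : 0 <= b) by (unfold b; repeat apply Rmult_le_pos; lra).
  destruct (nfloor_ex b b0) as (N & HN).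
  (* One query more than the floor of [b] makes the count exceed the length of [L]. *)
  exists (S N), (fun l => ask (wanted eps m) (run (wanted eps m) l)),
    (fun l => epsilon (inhabits (fun _ => 0)) (fun G => fits eps G (run (wanted eps m) l))).
  split.
  - rewrite S_INR, pow_1.
    assert (b <= 10755 * (4 * ln (/ eps)) * / sqrt eps)
      by (unfold b; apply Rmult_le_compat; lra).
    assert (1 <= / sqrt eps * ln (/ eps)) by nra. lra.
  - intros F f f' a Hsm Hor.
    assert (HF := smooth_regular_01_regular_cdf F f f' Hsm).
    assert (fitF := oracle_consistent_fits (wanted eps m) eps F (S N) a HF Hor).
    set (G := epsilon _ _).
    assert (fitG : fits eps G (run (wanted eps m) (prefix a (S N))))
      by (apply epsilon_spec; now exists F).
    destruct (wanted_list eps m F ltac:(lra) HF) as (L & HL & Hlen).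
    (* Nothing is wanted at some stage [i], perhaps before the last; [F] and [G] fit all answers,
       hence also the first [i]. *)
    destruct (want_exhausted (wanted eps m) a (S N) L) as (i & Hi & Hw).
    + intros st x (k & j & _ & _ & Hx). exact Hx.
    + intros i x Hi. apply HL. apply fits_prefix with (S N); [lia | exact fitF].
    + apply INR_lt. rewrite S_INR. fold b in Hlen. lra.
    + apply Rbar_le_trans with (1040 * eps); [|simpl; lra].
      apply levy_le; [|lra|exact HF|apply fitG].
      intros v Hv.
      assert (d0 : 0 < mesh eps m) by (generalize (mesh_ge eps m (proj1 He)); lra).
      destruct (nfloor_ex (v / mesh eps m)) as (j & Hj).
      { apply Rmult_le_pos; [lra | left; now apply Rinv_0_lt_compat]. }
      assert (Hvj : INR j * mesh eps m <= v < (INR j + 1) * mesh eps m).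
      { replace v with (v / mesh eps m * mesh eps m) by (field; lra).
        split; [apply Rmult_le_compat_r | apply Rmult_lt_compat_r]; lra. }
      (* The top-level cells cover [[0, 1]]: their total length is [64 * (2 ^ m * sqrt eps) ^ 2],
         where [2 ^ m * sqrt eps > / 2]. *)
      assert (big : 1 < 2 ^ m * mesh eps m).
      { change (2 ^ S m) with (2 * 2 ^ m) in Hm'.
        assert (1 < 2 * (2 ^ m * sqrt eps)).
        { apply Rmult_lt_compat_r with (r := sqrt eps) in Hm'; [|lra].
          rewrite Rinv_l in Hm'; lra. }
        unfold mesh. rewrite <- ss.
        replace (2 ^ m * (64 * (sqrt eps * sqrt eps) * 2 ^ m))
          with (64 * ((2 ^ m * sqrt eps) * (2 ^ m * sqrt eps))) by ring.
        nra. }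
      apply (close_of_nothing_wanted eps m (run (wanted eps m) (prefix a i)))
        with (k := m) (j := j); try lra.
      * exact Hw.
      * now apply fits_prefix with (S N).
      * now apply fits_prefix with (S N).
      * apply reached_top. apply INR_lt. rewrite pow_INR.
        replace (INR 2) with 2 by (simpl; ring).
        apply Rmult_lt_reg_r with (mesh eps m); lra.
Qed.
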